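(* For every real $\alpha\in(3/2,+\infty)$, $\mathcal{G}(\alpha)\not\subset\mathcal{S}$; that is, the class $\mathcal{G}(\alpha)$ contains a function that is not univalent in $\mathbb{D}$.
   Context: $\mathbb{D}=\{z\in\mathbb{C}:|z|<1\}$. $\mathcal{A}$ is the class of functions $h$ analytic in $\mathbb{D}$ of the form $h(z)=z+\sum_{k=2}^{\infty}a_kz^k$. For $\alpha>1$, $\mathcal{G}(\alpha)$ is the class of $h\in\mathcal{A}$ satisfying $\mathrm{Re}\left(1+\frac{zh''(z)}{h'(z)}\right)<\alpha$ for all $z\in\mathbb{D}$. $\mathcal{S}$ is the class of functions in $\mathcal{A}$ that are univalent (injective) in $\mathbb{D}$. *)

(* Defs.v *)
From Stdlib Require Import Reals.
From Coquelicot Require Import Coquelicot.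

Open Scope C_scope.

Definition unit_disk (z : C) : Prop := (Cmod z < 1)%R.

(* A function on the disk is represented by a total function [h : C -> C].  All
   the predicates below depend only on the values of [h] on the open disk. *)

Definition holomorphic_on_disk (h : C -> C) : Prop :=
  forall z : C, unit_disk z -> ex_derive h z.

Definition class_A (h : C -> C) : Prop :=
  holomorphic_on_disk h /\
  exists a : nat -> C,
    a 0%nat = 0 /\ a 1%nat = 1 /\
    forall z : C, unit_disk z -> is_pseries a z (h z).

(* [C_derive] is total, but it returns the complex derivative wherever the
   function is complex differentiable ([C_derive_correct]); this covers [h] and
   [h'] on the disk when [h] is in [class_A].  The condition [h' z <> 0] makes
   the quotient meaningful: at a zero of [h'], Coquelicot's division would return
   the junk value 0. *)
Definition class_G (alpha : R) (h : C -> C) : Prop :=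
  class_A h /\
  forall z : C, unit_disk z ->
    C_derive h z <> 0 /\
    (Re (1 + z * C_derive (C_derive h) z / C_derive h z) < alpha)%R.

Definition univalent_on_disk (h : C -> C) : Prop :=
  forall z w : C, unit_disk z -> unit_disk w -> h z = h w -> z = w.

Definition class_S (h : C -> C) : Prop :=
  class_A h /\ univalent_on_disk h.

(* Main.v *)
Require Import Defs.
From Stdlib Require Import Reals Lra Lia.
From Coquelicot Require Import Coquelicot.

(** The function [h(z) = (1 - (1 - z)^p) / p] with [p = 2 alpha - 1 > 2] lies in the
    class and is not univalent.

    Since [h'(z) = (1 - z)^(p - 1)], one has
    [1 + z h''(z) / h'(z) = 1 - (p - 1) z / (1 - z)].  The real part of [z / (1 - z)] on
    the disk exceeds [-1/2], so the real part of this expression is less than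
    [1 + (p - 1) / 2 = alpha] ([class_G_extremal]).  On the other hand [1 - z] ranges
    over a disk tangent to the imaginary axis at 0, so it takes values of equal
    modulus and of arguments [PI / p] and [- PI / p], both less than [PI / 2] in
    absolute value because [p > 2].  Their [p]-th powers have arguments [PI] and
    [- PI] and coincide ([extremal_not_univalent]).

    The power is [exp (p log w)], with exponential and logarithm written in real
    coordinates and differentiated through the Cauchy-Riemann equations
    ([is_derive_Cpow_real]).  Its Taylor expansion ([is_pseries_binom]) comes from a
    uniqueness argument for differential equations: on the ray from 0 to [z], the
    binomial series and [(1 - t z)^p] satisfy the same first-order linear
    differential equation with the same initial value. *)

Open Scope R_scope.

Local Notation is_C_derive := (is_derive (K := C_AbsRing) (V := C_NormedModule)).

(** * Real differentiability in the plane and complex derivatives *)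

Lemma differentiable_pt_lim_val (f : R -> R -> R) (x y lx ly mx my : R) :
  differentiable_pt_lim f x y lx ly -> lx = mx -> ly = my ->
  differentiable_pt_lim f x y mx my.
Proof. now intros H -> ->. Qed.

Lemma differentiable_pt_lim_fst (x y : R) :
  differentiable_pt_lim (fun u _ => u) x y 1 0.
Proof. apply differentiable_pt_lim_proj1_0, derivable_pt_lim_id. Qed.

Lemma differentiable_pt_lim_snd (x y : R) :
  differentiable_pt_lim (fun _ v => v) x y 0 1.
Proof.
  intros eps; exists eps; intros u v _ _.
  replace (v - y - (0 * (u - x) + 1 * (v - y))) with 0 by ring.
  rewrite Rabs_R0. apply Rmult_le_pos; [apply Rlt_le, cond_pos |].
  apply Rle_trans with (2 := Rmax_l _ _), Rabs_pos.
Qed.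

Lemma differentiable_pt_lim_Rmult (x y : R) :
  differentiable_pt_lim Rmult x y y x.
Proof.
  intros eps; exists eps; intros u v Hu _.
  replace (u * v - x * y - (y * (u - x) + x * (v - y)))
    with ((u - x) * (v - y)) by ring.
  rewrite Rabs_mult.
  apply Rmult_le_compat; try apply Rabs_pos; [lra | apply Rmax_r].
Qed.

Lemma differentiable_pt_lim_mult (f g : R -> R -> R) (x y fx fy gx gy : R) :
  differentiable_pt_lim f x y fx fy -> differentiable_pt_lim g x y gx gy ->
  differentiable_pt_lim (fun u v => f u v * g u v) x y
    (g x y * fx + f x y * gx) (g x y * fy + f x y * gy).
Proof.
  intros Hf Hg.
  exact (differentiable_pt_lim_comp Rmult f g x y _ _ _ _ _ _
           (differentiable_pt_lim_Rmult _ _) Hf Hg).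
Qed.

Lemma differentiable_pt_lim_comp1 (g : R -> R) (f : R -> R -> R)
    (x y l fx fy : R) :
  is_derive g (f x y) l -> differentiable_pt_lim f x y fx fy ->
  differentiable_pt_lim (fun u v => g (f u v)) x y (l * fx) (l * fy).
Proof.
  intros Hg Hf.
  apply is_derive_Reals in Hg.
  apply differentiable_pt_lim_proj1_0 with (y := f x y) in Hg.
  apply differentiable_pt_lim_val with
    (1 := differentiable_pt_lim_comp _ f f x y _ _ _ _ _ _ Hg Hf Hf); ring.
Qed.

Lemma differentiable_pt_lim_plus (f g : R -> R -> R) (x y fx fy gx gy : R) :
  differentiable_pt_lim f x y fx fy -> differentiable_pt_lim g x y gx gy ->
  differentiable_pt_lim (fun u v => f u v + g u v) x y (fx + gx) (fy + gy).
Proof.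
  rewrite <- !filterdiff_differentiable_pt_lim; intros Hf Hg.
  eapply filterdiff_ext_lin; [apply (filterdiff_plus_fct _ _ _ _ Hf Hg) |].
  intros [u v]; simpl; unfold plus; simpl; ring.
Qed.

(** Cauchy-Riemann: the increment of [f] is controlled componentwise by the two
    real differentials, which together are multiplication by [l]. *)
Lemma is_derive_cauchy_riemann (f : C -> C) (z l : C) :
  differentiable_pt_lim (fun x y => Re (f (x, y))) (Re z) (Im z) (Re l) (- Im l) ->
  differentiable_pt_lim (fun x y => Im (f (x, y))) (Re z) (Im z) (Im l) (Re l) ->
  is_C_derive f z l.
Proof.
  intros Hu Hv; split; [apply is_linear_scal_l |].
  intros w Hw.
  apply (is_filter_lim_locally_unique (V := AbsRing_NormedModule C_AbsRing)) in Hw.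
  subst w.
  intros eps.
  (* The modulus is at most sqrt 2 <= 2 times the larger component, so each
     component is asked to be small up to eps / 2. *)
  assert (Heps : 0 < eps / 2) by (pose proof (cond_pos eps); lra).
  destruct (Hu (mkposreal _ Heps)) as [d1 H1], (Hv (mkposreal _ Heps)) as [d2 H2].
  assert (Hd : 0 < Rmin d1 d2) by (apply Rmin_pos; apply cond_pos).
  exists (mkposreal _ Hd); intros w Hw.
  change (Cmod (w - z) < Rmin d1 d2) in Hw.
  change (Cmod (f w - f z - (w - z) * l) <= eps * Cmod (w - z)).
  pose proof (Rmin_l d1 d2) as M1; pose proof (Rmin_r d1 d2) as M2.
  pose proof (Rmax_Cmod (w - z)%C) as Hm.
  pose proof (Rmax_l (Rabs (Re (w - z)%C)) (Rabs (Im (w - z)%C))) as L1.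
  pose proof (Rmax_r (Rabs (Re (w - z)%C)) (Rabs (Im (w - z)%C))) as L2.
  destruct w as [a b], z as [x y], l as [p q]; simpl in *.
  change (a + - x) with (a - x) in *; change (b + - y) with (b - y) in *.
  set (N := Cmod _) in *.
  specialize (H1 a b ltac:(lra) ltac:(lra)).
  specialize (H2 a b ltac:(lra) ltac:(lra)).
  set (m := Rmax _ _) in *.
  assert (Hm' : eps / 2 * m <= eps / 2 * N) by (apply Rmult_le_compat_l; lra).
  eapply Rle_trans; [apply Cmod_2Rmax |].
  apply Rle_trans with (2 * (eps / 2 * N)); [| lra].
  apply Rmult_le_compat; [apply sqrt_pos | | |].
  - eapply Rle_trans; [apply Rabs_pos | apply Rmax_l].
  - pose proof (sqrt_square 2 ltac:(lra)) as H4; rewrite <- H4 at 2.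
    apply sqrt_le_1_alt; lra.
  - apply Rmax_lub; simpl.
    + eapply Rle_trans; [| exact Hm']. eapply Rle_trans; [| exact H1].
      apply Req_le; f_equal; unfold Re; simpl; ring.
    + eapply Rle_trans; [| exact Hm']. eapply Rle_trans; [| exact H2].
      apply Req_le; f_equal; unfold Im; simpl; ring.
Qed.

(** [C] carries two normed-module structures over itself, with the same norm but
    differently presented balls.  Chain and product rules need the inner
    function to take values in the second one. *)
Lemma is_derive_C_AbsRing (f : C -> C) (z l : C) :
  is_C_derive f z l ->
  is_derive (K := C_AbsRing) (V := AbsRing_NormedModule C_AbsRing) f z l.
Proof. intros [_ H]; split; [apply is_linear_scal_l | exact H]. Qed.

(** A complex derivative at a real point restricts to a derivative along the real
    axis; this lets the real constancy theorem be applied to complex functions. *)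
Lemma is_derive_Re_Im_real (g : C -> C) (t : R) (l : C) :
  is_C_derive g (RtoC t) l ->
  is_derive (fun s : R => Re (g s)) t (Re l) /\
  is_derive (fun s : R => Im (g s)) t (Im l).
Proof.
  intros [_ H]. specialize (H (RtoC t) (fun P HP => HP)).
  split; (split; [apply is_linear_scal_l |]);
    intros t' Ht';
    apply (is_filter_lim_locally_unique (V := R_NormedModule)) in Ht'; subst t';
    intros eps; destruct (H eps) as [d Hd]; exists d; intros s Hs;
    (assert (Hs' : Cmod (s - t) < d) by
      (rewrite <- RtoC_minus, Cmod_R; exact Hs));
    specialize (Hd (RtoC s) Hs');
    change (Cmod (g s - g t - (s - t) * l) <= eps * Cmod (s - t)) in Hd;
    rewrite <- RtoC_minus, Cmod_R in Hd;
    eapply Rle_trans; try exact Hd.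
  - eapply Rle_trans; [| apply re_le_Cmod].
    apply Req_le; destruct (g s), (g t), l;
      unfold norm, minus, plus, opp, scal; simpl;
      unfold abs, mult; simpl; f_equal; ring.
  - eapply Rle_trans; [| eapply Rle_trans; [apply Rmax_r | apply Rmax_Cmod]].
    apply Req_le; destruct (g s), (g t), l;
      unfold norm, minus, plus, opp, scal; simpl;
      unfold abs, mult; simpl; f_equal; ring.
Qed.

(** * The complex exponential, logarithm and real powers *)

Definition Cexp (w : C) : C := (exp (Re w) * cos (Im w), exp (Re w) * sin (Im w)).

(** Principal branch on the right half-plane, the only region where it is used:
    there the argument of [w] is the arctangent of its slope. *)
Definition Clog (w : C) : C :=
  (ln (Re w * Re w + Im w * Im w) / 2, atan (Im w * / Re w)).

Definition Cpow_real (w : C) (p : R) : C := Cexp (p * Clog w).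

Lemma Cexp_plus (a b : C) : Cexp (a + b) = (Cexp a * Cexp b)%C.
Proof.
  destruct a as [a1 a2], b as [b1 b2]; unfold Cexp, Cmult, Re, Im; simpl.
  rewrite exp_plus, cos_plus, sin_plus; f_equal; ring.
Qed.

Lemma Cexp_0 : Cexp 0 = 1.
Proof. unfold Cexp; simpl. rewrite exp_0, cos_0, sin_0. unfold RtoC; f_equal; ring. Qed.

Lemma Cexp_neq_0 (a : C) : Cexp a <> 0.
Proof.
  intros H. apply C1_nz. rewrite <- Cexp_0.
  replace (RtoC 0) with (a + - a)%C by ring. rewrite Cexp_plus, H; ring.
Qed.

Lemma Re_neq_0 (w : C) : 0 < Re w -> w <> 0.
Proof. intros H ->; simpl in H; lra. Qed.

Lemma Cexp_Clog (w : C) : 0 < Re w -> Cexp (Clog w) = w.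
Proof.
  destruct w as [x y]; unfold Cexp, Clog, Re, Im; simpl; intros Hx.
  assert (Hpos : 0 < x * x + y * y) by nra.
  assert (Hexp : exp (ln (x * x + y * y) / 2) = sqrt (x * x + y * y)).
  { rewrite <- Rpower_sqrt by assumption; unfold Rpower; f_equal; field. }
  assert (Hsqrt : sqrt (1 + (y * / x)²) = sqrt (x * x + y * y) / x).
  { replace (1 + (y * / x)²) with ((x * x + y * y) / (x * x))
      by (unfold Rsqr; field; lra).
    rewrite sqrt_div by nra. now rewrite sqrt_square by lra. }
  pose proof (sqrt_lt_R0 _ Hpos).
  rewrite cos_atan, sin_atan, Hsqrt, Hexp. f_equal; field; lra.
Qed.

Lemma is_derive_Cexp (w : C) :
  is_C_derive Cexp w (Cexp w).
Proof.
  destruct w as [a b].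
  apply is_derive_cauchy_riemann; unfold Cexp; simpl;
  (eapply differentiable_pt_lim_val;
   [ apply differentiable_pt_lim_mult; apply differentiable_pt_lim_comp1;
     first [ apply differentiable_pt_lim_fst | apply differentiable_pt_lim_snd
           | auto_derive; [exact I | reflexivity] ]
   | simpl; ring | simpl; ring ]).
Qed.

Lemma is_derive_Clog (w : C) :
  0 < Re w -> is_C_derive Clog w (/ w)%C.
Proof.
  destruct w as [x y]; simpl; intros Hx.
  assert (Hpos : 0 < x * x + y * y) by nra.
  apply is_derive_cauchy_riemann; unfold Clog; simpl.
  - eapply differentiable_pt_lim_val.
    + apply (differentiable_pt_lim_comp1 (fun t => ln t / 2)
               (fun u v => u * u + v * v)).
      * auto_derive; [exact Hpos | reflexivity].
      * apply differentiable_pt_lim_plus; apply differentiable_pt_lim_mult;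
          first [ apply differentiable_pt_lim_fst | apply differentiable_pt_lim_snd ].
    + simpl; field; nra.
    + simpl; field; nra.
  - eapply differentiable_pt_lim_val.
    + apply (differentiable_pt_lim_comp1 atan (fun u v => v * / u)).
      * auto_derive; [exact I | reflexivity].
      * apply differentiable_pt_lim_mult; [apply differentiable_pt_lim_snd |].
        apply (differentiable_pt_lim_comp1 Rinv (fun u _ => u)).
        -- auto_derive; [lra | reflexivity].
        -- apply differentiable_pt_lim_fst.
    + simpl; field; repeat split; nra.
    + simpl; field; repeat split; nra.
Qed.

Lemma Cpow_real_plus (w : C) (p q : R) :
  Cpow_real w (p + q) = (Cpow_real w p * Cpow_real w q)%C.
Proof.
  unfold Cpow_real. rewrite <- Cexp_plus, RtoC_plus. f_equal; ring.
Qed.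

Lemma Cpow_real_0 (w : C) : Cpow_real w 0 = 1.
Proof. unfold Cpow_real. rewrite Cmult_0_l. apply Cexp_0. Qed.

Lemma Cpow_real_1 (w : C) : 0 < Re w -> Cpow_real w 1 = w.
Proof. intros H; unfold Cpow_real; rewrite Cmult_1_l; now apply Cexp_Clog. Qed.

Lemma is_derive_Cpow_real (w : C) (p : R) :
  0 < Re w ->
  is_C_derive (fun w => Cpow_real w p) w
    (p * Cpow_real w (p - 1))%C.
Proof.
  intros Hw.
  evar_last.
  { apply (is_derive_comp (K := C_AbsRing) (V := C_NormedModule)
      Cexp (fun w => (p * Clog w)%C)).
    - apply is_derive_Cexp.
    - apply (is_derive_mult (K := C_AbsRing) (fun _ => RtoC p) Clog w zero (/ w)%C).
      + apply @is_derive_const.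
      + now apply is_derive_C_AbsRing, is_derive_Clog.
      + exact Cmult_comm. }
  change ((0 * Clog w + p * / w) * Cpow_real w p = p * Cpow_real w (p - 1))%C.
  replace (Cpow_real w p) with (Cpow_real w (p - 1) * w)%C.
  - field. now apply Re_neq_0.
  - rewrite <- (Cpow_real_1 w Hw) at 2. rewrite <- Cpow_real_plus. f_equal; ring.
Qed.

(** * The binomial series of (1 - z)^p in the unit disk *)

(** The Taylor coefficient of [(1 - z)^p], that is [(-1)^k] times the binomial
    coefficient [p] over [k]; the recursion absorbs the sign. *)
Fixpoint binom_coef (p : R) (k : nat) : R :=
  match k with
  | O => 1
  | S n => binom_coef p n * (INR n - p) / INR (S n)
  end.

(** The ratio [(k - p) / (k + 1)] of consecutive coefficients has absolute value
    at most 1 as soon as [k >= p], because [-1 <= p]. *)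
Lemma binom_coef_bounded (p : R) :
  -1 <= p -> exists M, forall k, Rabs (binom_coef p k) <= M.
Proof.
  intros Hp.
  destruct (nfloor_ex (Rabs p) (Rabs_pos p)) as [N [_ HN]].
  assert (Habs : Rabs p <= INR (S N)) by (rewrite S_INR; lra).
  assert (Hfirst : forall n, exists M, forall k, (k <= n)%nat ->
    Rabs (binom_coef p k) <= M).
  { induction n as [|n [M HM]].
    - exists 1. intros k Hk. replace k with 0%nat by lia. simpl. rewrite Rabs_R1; lra.
    - exists (Rmax M (Rabs (binom_coef p (S n)))). intros k Hk.
      destruct (Nat.eq_dec k (S n)) as [-> | Hne]; [apply Rmax_r |].
      eapply Rle_trans; [apply HM; lia | apply Rmax_l]. }
  destruct (Hfirst (S N)) as [M HM]. exists M.
  assert (Htail : forall j, Rabs (binom_coef p (S N + j)) <= M).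
  { induction j as [|j IH]; [apply HM; lia |].
    replace (S N + S j)%nat with (S (S N + j)) by lia.
    eapply Rle_trans; [| exact IH].
    pose proof (Rle_abs p).
    assert (Hk : p <= INR (S N + j)) by (rewrite plus_INR; pose proof (pos_INR j); lra).
    set (k := (S N + j)%nat) in *.
    cbn [binom_coef]. unfold Rdiv. rewrite Rmult_assoc, Rabs_mult.
    rewrite <- (Rmult_1_r (Rabs (binom_coef p k))) at 2.
    apply Rmult_le_compat_l; [apply Rabs_pos |].
    pose proof (pos_INR k).
    rewrite S_INR. apply Rabs_le; split.
    - apply Rle_trans with 0; [lra |].
      apply Rmult_le_pos; [lra | apply Rlt_le, Rinv_0_lt_compat; lra].
    - apply Rmult_le_reg_r with (INR k + 1); [lra |]. field_simplify; lra. }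
  intros k. destruct (Nat.le_gt_cases k (S N)) as [H | H]; [now apply HM |].
  replace k with (S N + (k - S N))%nat by lia. apply Htail.
Qed.

(** Along the ray [t |-> t z] the binomial series is a pair of real power series
    in [t]; these are the coefficients of its real and imaginary parts. *)
Definition re_binom (p : R) (z : C) (k : nat) : R := binom_coef p k * Re (z ^ k)%C.
Definition im_binom (p : R) (z : C) (k : nat) : R := binom_coef p k * Im (z ^ k)%C.

Lemma im_le_Cmod (z : C) : Rabs (Im z) <= Cmod z.
Proof. eapply Rle_trans; [apply Rmax_r | apply Rmax_Cmod]. Qed.

(** The coefficients are bounded by [M |z|^k], so the radius is at least [1 / |z|],
    hence exceeds 1 and the endpoint [t = 1] of the ray is interior. *)
Lemma CV_radius_binom (p : R) (z : C) (w : C -> R) (t : R) :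
  -1 <= p -> Cmod z < 1 -> (forall u, Rabs (w u) <= Cmod u) -> 0 <= t <= 1 ->
  Rbar_lt (Rabs t) (CV_radius (fun k => binom_coef p k * w (z ^ k)%C)).
Proof.
  intros Hp Hz Hw Ht.
  destruct (binom_coef_bounded p Hp) as [M HM].
  pose proof (Cmod_ge_0 z) as Hz0.
  (* A number strictly between 1 and 1 / |z|, chosen so that z = 0 needs no
     separate treatment. *)
  set (s := 2 / (1 + Cmod z)).
  assert (Hs : 1 < s).
  { unfold s. apply Rmult_lt_reg_r with (1 + Cmod z); [lra |]. field_simplify; lra. }
  assert (Hs0 : Cmod z * s <= 1).
  { unfold s. apply Rmult_le_reg_r with (1 + Cmod z); [lra |]. field_simplify; lra. }
  assert (Hr : Rbar_le s (CV_radius (fun k => binom_coef p k * w (z ^ k)%C))).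
  { destruct (CV_radius_bounded (fun k => binom_coef p k * w (z ^ k)%C)) as [Hub _].
    apply Hub. exists M. intros n.
    rewrite Rmult_assoc, Rabs_mult.
    rewrite <- (Rmult_1_r M).
    apply Rmult_le_compat; try apply Rabs_pos; [apply HM |].
    rewrite Rabs_mult, <- RPow_abs, (Rabs_right s) by lra.
    apply Rle_trans with (Cmod z ^ n * s ^ n).
    - apply Rmult_le_compat_r; [apply pow_le; lra |].
      rewrite <- Cmod_pow. apply Hw.
    - rewrite <- Rpow_mult_distr, <- (pow1 n). apply pow_incr.
      split; [apply Rmult_le_pos; lra | exact Hs0]. }
  eapply Rbar_lt_le_trans; [| exact Hr].
  simpl. rewrite Rabs_right; lra.
Qed.

(** Half of a complex first-order equation [(1 - t z) F' = - p z F] for a pair of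
    real power series; the other half is the same lemma with the two series
    exchanged and the sign of [y] reversed. *)
Lemma PSeries_ode (p x y t : R) (A B : nat -> R) :
  ex_pseries (PS_derive A) t -> ex_pseries (PS_derive B) t ->
  ex_pseries A t -> ex_pseries B t ->
  (forall k, PS_derive A k
     - PS_incr_1 (fun n => x * PS_derive A n + y * PS_derive B n) k
     + p * (x * A k + y * B k) = 0) ->
  PSeries (PS_derive A) t
    - t * (x * PSeries (PS_derive A) t + y * PSeries (PS_derive B) t)
    + p * (x * PSeries A t + y * PSeries B t) = 0.
Proof.
  intros HA' HB' HA HB H.
  apply PSeries_correct in HA, HB, HA', HB'.
  set (a := PSeries A t) in *. set (b := PSeries B t) in *.
  set (a' := PSeries (PS_derive A) t) in *. set (b' := PSeries (PS_derive B) t) in *.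
  pose proof (fun c => is_pseries_scal c _ _ _ (Rmult_comm t c) HA) as HcA.
  pose proof (fun c => is_pseries_scal c _ _ _ (Rmult_comm t c) HB) as HcB.
  pose proof (fun c => is_pseries_scal c _ _ _ (Rmult_comm t c) HA') as HcA'.
  pose proof (fun c => is_pseries_scal c _ _ _ (Rmult_comm t c) HB') as HcB'.
  pose proof (is_pseries_incr_1 _ _ _
    (is_pseries_plus _ _ _ _ _ (HcA' (- x)) (HcB' (- y)))) as H1.
  pose proof (is_pseries_plus _ _ _ _ _ HA' H1) as H2.
  pose proof (is_pseries_plus _ _ _ _ _ H2
    (is_pseries_plus _ _ _ _ _ (HcA (p * x)) (HcB (p * y)))) as H3.
  apply is_pseries_unique in H3.
  rewrite (PSeries_ext _ (fun _ => 0)), PSeries_const_0 in H3.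
  - unfold plus, scal in H3; simpl in H3; unfold mult in H3; simpl in H3. lra.
  - intros k. rewrite <- (H k).
    unfold PS_plus, PS_scal, PS_incr_1, plus, scal; simpl; unfold mult, zero; simpl.
    destruct k; simpl; ring.
Qed.

Lemma binom_coef_S (p : R) (k : nat) :
  INR (S k) * binom_coef p (S k) = binom_coef p k * (INR k - p).
Proof. cbn [binom_coef]. field. apply not_0_INR; lia. Qed.

(** The recursion of the coefficients is this differential equation, which
    [t |-> (1 - t z)^p] also satisfies. *)
Lemma binom_ode (p : R) (z : C) (t : R) :
  -1 <= p -> Cmod z < 1 -> 0 <= t <= 1 ->
  let F := (PSeries (re_binom p z) t, PSeries (im_binom p z) t) in
  let F' := (PSeries (PS_derive (re_binom p z)) t,
             PSeries (PS_derive (im_binom p z)) t) in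
  ((1 - t * z) * F' = - (p * z) * F)%C.
Proof.
  intros Hp Hz Ht.
  pose proof (CV_radius_binom p z Re t Hp Hz re_le_Cmod Ht) as Hre.
  pose proof (CV_radius_binom p z Im t Hp Hz im_le_Cmod Ht) as Him.
  pose proof (PSeries_ode p (Re z) (- Im z) t (re_binom p z) (im_binom p z)
    (ex_pseries_derive _ _ Hre) (ex_pseries_derive _ _ Him)
    (CV_radius_inside _ _ Hre) (CV_radius_inside _ _ Him)) as E1.
  pose proof (PSeries_ode p (Re z) (Im z) t (im_binom p z) (re_binom p z)
    (ex_pseries_derive _ _ Him) (ex_pseries_derive _ _ Hre)
    (CV_radius_inside _ _ Him) (CV_radius_inside _ _ Hre)) as E2.
  lapply E1; clear E1; [intros E1; lapply E2; clear E2; [intros E2 |] |].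
  { destruct z as [x y]; unfold Cmult, Cminus, Cplus, Copp, RtoC, Re, Im in *; simpl in *.
    f_equal; simpl; lra. }
  all: intros k; unfold PS_derive, re_binom, im_binom;
    destruct k; unfold PS_incr_1; cbv beta; rewrite <- !Rmult_assoc, !binom_coef_S.
  1, 3: unfold zero, Re, Im; simpl; ring.
  all: rewrite !(Cpow_S _ (S k)); set (u := (z ^ S k)%C);
    destruct z as [x y], u as [a b]; unfold Re, Im; cbn -[INR binom_coef]; ring.
Qed.

Lemma Cpow_real_opp (w : C) (p : R) : (Cpow_real w p * Cpow_real w (- p) = 1)%C.
Proof. rewrite <- Cpow_real_plus, Rplus_opp_r. apply Cpow_real_0. Qed.

Lemma Re_one_minus_pos (z : C) : Cmod z < 1 -> 0 < Re (1 - z)%C.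
Proof.
  intros Hz. pose proof (re_le_Cmod z) as H. pose proof (Rle_abs (Re z)).
  unfold Re in *; simpl. lra.
Qed.

Lemma is_derive_Cpow_real_affine (z c : C) (p : R) :
  0 < Re (1 - c * z)%C ->
  is_C_derive
    (fun s => Cpow_real (1 - s * z)%C p) c
    (- z * (p * Cpow_real (1 - c * z) (p - 1)))%C.
Proof.
  intros H.
  apply (is_derive_comp (K := C_AbsRing) (V := C_NormedModule)
           (fun w => Cpow_real w p) (fun s => 1 - s * z)%C).
  - now apply is_derive_Cpow_real.
  - evar_last.
    + apply (is_derive_minus (K := C_AbsRing) (V := AbsRing_NormedModule C_AbsRing)
               (fun _ => RtoC 1) (fun s => Cmult s z)).
      * apply @is_derive_const.
      * apply (is_derive_mult (K := C_AbsRing) (fun s => s) (fun _ => z)).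
        -- apply @is_derive_id.
        -- apply @is_derive_const.
        -- exact Cmult_comm.
    + change (0 - (1 * z + c * 0) = - z)%C. ring.
Qed.

Lemma is_derive_Cpow_real_one_minus (z : C) (p : R) :
  Cmod z < 1 ->
  is_C_derive
    (fun w => Cpow_real (1 - w)%C p) z (- (p * Cpow_real (1 - z) (p - 1)))%C.
Proof.
  intros Hz.
  apply is_derive_ext with (fun w => Cpow_real (1 - w * 1)%C p).
  - intros w. now rewrite Cmult_1_r.
  - evar_last.
    + apply is_derive_Cpow_real_affine. rewrite Cmult_1_r. now apply Re_one_minus_pos.
    + rewrite Cmult_1_r.
      change (- (1) * (p * Cpow_real (1 - z) (p - 1))
              = - (p * Cpow_real (1 - z) (p - 1)))%C. ring.
Qed.

(** [F(t) (1 - t z)^(-p)] has zero derivative on [[0, 1]] by [binom_ode], so it keeps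
    its value 1 from [t = 0] up to [t = 1]. *)
Lemma binom_sum_components (p : R) (z : C) :
  -1 <= p -> Cmod z < 1 ->
  (PSeries (re_binom p z) 1, PSeries (im_binom p z) 1) = Cpow_real (1 - z) p.
Proof.
  intros Hp Hz.
  set (F := fun t => (PSeries (re_binom p z) t, PSeries (im_binom p z) t) : C).
  set (G := fun c => Cpow_real (1 - c * z) (- p)).
  assert (Hder : forall t, 0 <= t <= 1 ->
    is_derive (fun t => Re (F t * G t)%C) t 0 /\
    is_derive (fun t => Im (F t * G t)%C) t 0).
  { intros t Ht.
    pose proof (is_derive_PSeries _ _
      (CV_radius_binom p z Re t Hp Hz re_le_Cmod Ht)) as HF1.
    pose proof (is_derive_PSeries _ _
      (CV_radius_binom p z Im t Hp Hz im_le_Cmod Ht)) as HF2.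
    assert (Hpos : 0 < Re (1 - t * z)%C).
    { apply Re_one_minus_pos. rewrite Cmod_mult, Cmod_R, Rabs_right by lra.
      pose proof (Cmod_ge_0 z). nra. }
    pose proof (is_derive_Cpow_real_affine z t (- p) Hpos) as HG.
    apply is_derive_Re_Im_real in HG. fold G in HG.
    pose proof (binom_ode p z t Hp Hz Ht) as Hode. cbv zeta in Hode.
    set (F' := (PSeries (PS_derive (re_binom p z)) t,
             PSeries (PS_derive (im_binom p z)) t) : C) in *.
    set (G' := (- z * ((- p)%R * Cpow_real (1 - t * z) (- p - 1)))%C) in *.
    assert (Hzero : (F' * G t + F t * G' = 0)%C).
    { assert (HGt : G t = ((1 - t * z) * Cpow_real (1 - t * z) (- p - 1))%C).
      { unfold G. replace (- p) with (1 + (- p - 1)) at 1 by ring.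
        now rewrite Cpow_real_plus, Cpow_real_1. }
      rewrite HGt. unfold G'. rewrite RtoC_opp.
      transitivity (((1 - t * z) * F' + p * z * F t)
        * Cpow_real (1 - t * z) (- p - 1))%C; [ring |].
      rewrite Hode. unfold F; ring. }
    change (is_derive (fun t => Re (F t)) t (Re F')) in HF1.
    change (is_derive (fun t => Im (F t)) t (Im F')) in HF2.
    destruct HG as [HG1 HG2]. split.
    - evar_last.
      + apply (is_derive_minus (V := R_NormedModule)
          (fun t => Re (F t) * Re (G t)) (fun t => Im (F t) * Im (G t)));
        apply (is_derive_mult (K := R_AbsRing)); eauto; exact Rmult_comm.
      + apply (f_equal Re) in Hzero. etransitivity; [| exact Hzero].
        unfold minus, plus, opp, mult; simpl. unfold Re, Im; simpl; ring.
    - evar_last.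
      + apply (is_derive_plus (V := R_NormedModule)
          (fun t => Re (F t) * Im (G t)) (fun t => Im (F t) * Re (G t)));
        apply (is_derive_mult (K := R_AbsRing)); eauto; exact Rmult_comm.
      + apply (f_equal Im) in Hzero. etransitivity; [| exact Hzero].
        unfold minus, plus, opp, mult; simpl. unfold Re, Im; simpl; ring. }
  assert (HFG : (F 0 * G 0 = F 1 * G 1)%C).
  { apply injective_projections.
    - apply (eq_is_derive (V := R_NormedModule) (fun t => Re (F t * G t)%C)); [| lra].
      intros t Ht; exact (proj1 (Hder t Ht)).
    - apply (eq_is_derive (V := R_NormedModule) (fun t => Im (F t * G t)%C)); [| lra].
      intros t Ht; exact (proj2 (Hder t Ht)). }
  assert (HF0 : F 0 = 1).
  { unfold F, RtoC. rewrite !PSeries_0.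
    unfold re_binom, im_binom, Re, Im; simpl. f_equal; ring. }
  assert (HG0 : G 0 = 1).
  { unfold G, Cpow_real. replace (1 - 0 * z)%C with (RtoC 1) by ring.
    replace (Clog 1) with (RtoC 0).
    - rewrite Cmult_0_r; apply Cexp_0.
    - unfold Clog, RtoC, Re, Im; simpl. replace (0 * / 1) with 0 by ring.
      replace (1 * 1 + 0 * 0) with 1 by ring. rewrite atan_0, ln_1. f_equal; field. }
  rewrite HF0, HG0 in HFG. unfold G in HFG. rewrite Cmult_1_l, Cmult_1_l in HFG.
  change (@eq C (F 1) (Cpow_real (1 - z) p)).
  pose proof (Cpow_real_opp (1 - z) p) as Hopp.
  transitivity (F 1%R * (Cpow_real (1 - z) p * Cpow_real (1 - z) (- p)))%C;
    [rewrite Hopp; ring |].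
  transitivity ((F 1%R * Cpow_real (1 - z) (- p)) * Cpow_real (1 - z) p)%C; [ring |].
  rewrite <- HFG. ring.
Qed.

Lemma is_series_C (a : nat -> C) (l : C) :
  is_series (fun n => Re (a n)) (Re l) -> is_series (fun n => Im (a n)) (Im l) ->
  is_series (K := C_AbsRing) (V := C_NormedModule) a l.
Proof.
  intros H1 H2.
  assert (Hsum : forall n, sum_n (G := C_NormedModule) a n
    = (sum_n (fun n => Re (a n)) n, sum_n (fun n => Im (a n)) n)).
  { induction n as [|n IH]; [rewrite !sum_O | rewrite !sum_Sn, IH];
      [destruct (a 0%nat) | destruct (a (S n))]; reflexivity. }
  unfold is_series.
  apply filterlim_ext with (1 := fun n => eq_sym (Hsum n)).
  destruct l as [x y].
  apply filterlim_locally. intros eps.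
  pose proof (proj1 (filterlim_locally _ _) H1 eps) as [N1 HN1].
  pose proof (proj1 (filterlim_locally _ _) H2 eps) as [N2 HN2].
  exists (max N1 N2). intros n Hn. split; [apply HN1 | apply HN2]; lia.
Qed.

Lemma is_pseries_binom (p : R) (z : C) :
  -1 <= p -> Cmod z < 1 ->
  is_pseries (K := C_AbsRing) (V := C_NormedModule)
    (fun k => RtoC (binom_coef p k)) z (Cpow_real (1 - z) p).
Proof.
  intros Hp Hz.
  assert (Hpow : forall k, pow_n (K := C_Ring) z k = (z ^ k)%C).
  { induction k as [|k IH]; [reflexivity |]. rewrite Cpow_S, <- IH; reflexivity. }
  rewrite <- binom_sum_components by assumption.
  assert (H01 : 0 <= 1 <= 1) by lra.
  pose proof (PSeries_correct _ _ (CV_radius_inside _ _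
    (CV_radius_binom p z Re 1 Hp Hz re_le_Cmod H01))) as H1.
  pose proof (PSeries_correct _ _ (CV_radius_inside _ _
    (CV_radius_binom p z Im 1 Hp Hz im_le_Cmod H01))) as H2.
  apply is_pseries_R in H1, H2.
  apply is_series_C.
  - apply is_series_ext with (2 := H1). intros n. rewrite pow1, Rmult_1_r.
    change (@eq R (re_binom p z n) (Re (pow_n (K := C_Ring) z n * binom_coef p n)%C)).
    rewrite Hpow.
    unfold re_binom, Re; simpl; ring.
  - apply is_series_ext with (2 := H2). intros n. rewrite pow1, Rmult_1_r.
    change (@eq R (im_binom p z n) (Im (pow_n (K := C_Ring) z n * binom_coef p n)%C)).
    rewrite Hpow.
    unfold im_binom, Im; simpl; ring.
Qed.

(** * The extremal function *)

(** The solution of [h' = (1 - z)^(p - 1)], [h(0) = 0]; with [p = 2 alpha - 1] it is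
    extremal for the bound defining the class. *)
Definition extremal (p : R) (z : C) : C := ((1 - Cpow_real (1 - z) p) / p)%C.

Lemma is_derive_one_minus_div (p u : C) :
  is_C_derive
    (fun u => (1 - u) / p)%C u (- / p)%C.
Proof.
  split; [apply is_linear_scal_l |].
  intros v _ eps. exists eps. intros w _.
  change (Cmod ((1 - w) / p - (1 - v) / p - (w - v) * (- / p)) <= eps * Cmod (w - v)).
  replace ((1 - w) / p - (1 - v) / p - (w - v) * (- / p))%C with (RtoC 0)
    by (unfold Cdiv; ring).
  rewrite Cmod_0. apply Rmult_le_pos; [apply Rlt_le, cond_pos | apply Cmod_ge_0].
Qed.

Lemma is_derive_extremal (p : R) (z : C) :
  p <> 0 -> Cmod z < 1 ->
  is_C_derive (extremal p) z
    (Cpow_real (1 - z) (p - 1)).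
Proof.
  intros Hp Hz.
  assert (HpC : RtoC p <> 0) by (intros H; apply Hp, RtoC_inj, H).
  evar_last.
  - apply (is_derive_comp (K := C_AbsRing) (V := C_NormedModule)
             (fun u => (1 - u) / p)%C (fun w => Cpow_real (1 - w)%C p)).
    + apply is_derive_one_minus_div.
    + now apply is_derive_C_AbsRing, is_derive_Cpow_real_one_minus.
  - change (- (p * Cpow_real (1 - z) (p - 1)) * (- / p) = Cpow_real (1 - z) (p - 1))%C.
    field. exact HpC.
Qed.

Lemma locally_unit_disk (z : C) :
  Cmod z < 1 -> locally (T := AbsRing_UniformSpace C_AbsRing) z (fun w => Cmod w < 1).
Proof.
  intros Hz. assert (He : 0 < 1 - Cmod z) by lra.
  exists (mkposreal _ He). intros w Hw.
  change (Cmod (w - z) < 1 - Cmod z) in Hw.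
  replace w with (w - z + z)%C by ring.
  eapply Rle_lt_trans; [apply Cmod_triangle |]. lra.
Qed.

Lemma class_A_extremal (p : R) : 0 < p -> class_A (extremal p).
Proof.
  intros Hp. split.
  - intros z Hz. eexists. apply is_derive_extremal; [lra | exact Hz].
  - exists (fun k => RtoC (((if Nat.eqb k 0 then 1 else 0) - binom_coef p k) / p)).
    split; [| split].
    + simpl. f_equal. field; lra.
    + simpl. f_equal. field; lra.
    + intros z Hz.
      pose proof (is_pseries_binom p z ltac:(lra) Hz) as H.
      assert (H1 : is_pseries (K := C_AbsRing) (V := C_NormedModule)
                     (fun k => RtoC (if Nat.eqb k 0 then 1 else 0)) z (RtoC 1)).
      { apply filterlim_ext with (fun _ : nat => RtoC 1); [| apply filterlim_const].
        induction x as [|n IH].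
        - rewrite sum_O. change (RtoC 1 = 1 * 1)%C. ring.
        - rewrite sum_Sn, <- IH.
          change (RtoC 1 = 1 + z * pow_n (K := C_Ring) z n * 0)%C. ring. }
      apply (is_pseries_minus _ _ _ _ _ H1) in H.
      apply (is_pseries_scal (/ RtoC p)%C _ _ _ (Cmult_comm _ _)) in H.
      unfold extremal, Cdiv. rewrite Cmult_comm.
      apply is_series_ext with (2 := H). intros n. f_equal.
      set (d := if Nat.eqb n 0 then 1 else 0).
      transitivity (/ p * (RtoC d - RtoC (binom_coef p n)))%C; [reflexivity |].
      rewrite RtoC_div, RtoC_minus by lra. unfold Cdiv. apply Cmult_comm.
Qed.

(** [z / (1 - z) = 1 / (1 - z) - 1], and [1 / (1 - z)] maps the disk onto the
    half-plane of real part greater than [1 / 2]. *)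
Lemma Re_quotient_lt (q : R) (z : C) :
  0 < q -> Cmod z < 1 -> Re (1 - q * (z / (1 - z)))%C < 1 + q / 2.
Proof.
  intros Hq Hz. pose proof (Re_one_minus_pos z Hz) as Hpos.
  assert (H2 : Re z * Re z + Im z * Im z < 1).
  { pose proof (Cmod_ge_0 z).
    replace (Re z * Re z + Im z * Im z) with (Cmod z * Cmod z); [nra |].
    unfold Cmod. rewrite sqrt_sqrt; unfold Re, Im; nra. }
  destruct z as [x y]. unfold Re, Im in *; simpl in *.
  assert (Hd : 0 < (1 - x) * (1 - x) + y * y) by nra.
  assert (Hhalf : 1 / 2 < (1 - x) / ((1 - x) * (1 - x) + y * y)).
  { apply Rmult_lt_reg_r with ((1 - x) * (1 - x) + y * y); [exact Hd |].
    field_simplify; nra. }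
  apply Rle_lt_trans with (1 + q - q * ((1 - x) / ((1 - x) * (1 - x) + y * y))); [| nra].
  apply Req_le. field. nra.
Qed.

Lemma class_G_extremal (alpha p : R) :
  1 < p -> (p + 1) / 2 <= alpha -> class_G alpha (extremal p).
Proof.
  intros Hp Hle. split; [apply class_A_extremal; lra |].
  intros z Hz.
  pose proof (is_C_derive_unique _ _ _ (is_derive_extremal p z ltac:(lra) Hz)) as H1.
  rewrite H1. split; [apply Cexp_neq_0 |].
  pose proof (Re_one_minus_pos z Hz) as Hpos.
  assert (H2 : C_derive (C_derive (extremal p)) z
    = (- ((p - 1)%R * Cpow_real (1 - z) (p - 1 - 1)))%C).
  { apply is_C_derive_unique.
    apply is_derive_ext_loc with (fun w => Cpow_real (1 - w) (p - 1)).
    - generalize (locally_unit_disk z Hz). apply filter_imp. intros w Hw.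
      symmetry; apply is_C_derive_unique, is_derive_extremal; [lra | exact Hw].
    - now apply is_derive_Cpow_real_one_minus. }
  rewrite H2.
  pose proof (Re_quotient_lt (p - 1) z ltac:(lra) Hz) as Hlt.
  eapply Rle_lt_trans; [| eapply Rlt_le_trans; [exact Hlt | lra]].
  apply Req_le. f_equal.
  replace (Cpow_real (1 - z) (p - 1)) with (Cpow_real (1 - z) (p - 1 - 1) * (1 - z))%C.
  - field. split; [now apply Re_neq_0 | apply Cexp_neq_0].
  - rewrite <- (Cpow_real_1 _ Hpos) at 2. rewrite <- Cpow_real_plus. f_equal; ring.
Qed.

(** The power [p] opens the half-plane of arguments in [(-PI/2, PI/2)] to total angle
    [p PI > 2 PI], so it overlaps itself: the points of argument [PI / p] and
    [- PI / p] and equal modulus have the same [p]-th power. *)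
Lemma extremal_not_univalent (p : R) : 2 < p -> ~ univalent_on_disk (extremal p).
Proof.
  intros Hp Huniv.
  set (th := PI / p).
  pose proof PI_RGT_0 as Hpi.
  assert (Hth : 0 < th < PI / 2).
  { unfold th; split; [apply Rdiv_lt_0_compat; lra |].
    apply Rmult_lt_compat_l; [lra |]. apply Rinv_lt_contravar; lra. }
  assert (Hpth : p * th = PI) by (unfold th; field; lra).
  assert (Hcos : 0 < cos th) by (apply cos_gt_0; lra).
  assert (Hsin : 0 < sin th) by (apply sin_gt_0; lra).
  pose proof (sin2_cos2 th) as Hsc. unfold Rsqr in Hsc.
  (* 1 - w s = cos th * exp (i s th) for s = 1 or -1.  The modulus cos th brings
     the point closest to 1, hence w s into the disk. *)
  set (w := fun s : R => (1 - cos th * cos th, - (s * (cos th * sin th))) : C).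
  assert (Hdisk : forall s, s = 1 \/ s = -1 -> unit_disk (w s)).
  { intros s Hs. unfold unit_disk, w, Cmod, fst, snd.
    apply Rlt_le_trans with (sqrt 1); [apply sqrt_lt_1_alt | rewrite sqrt_1; lra].
    split; [apply Rplus_le_le_0_compat; apply pow2_ge_0 |].
    replace (1 - cos th * cos th) with (sin th * sin th) by lra.
    apply Rle_lt_trans with (sin th * sin th); [| nra].
    apply Req_le.
    transitivity (sin th * sin th * (sin th * sin th + cos th * cos th)).
    - destruct Hs as [-> | ->]; ring.
    - rewrite Hsc; ring. }
  assert (Hlog : forall s, s = 1 \/ s = -1 ->
    Clog (1 - w s) = (ln (cos th * cos th) / 2, s * th)).
  { intros s Hs. unfold Clog. f_equal.
    - do 2 f_equal. unfold w, Re, Im; simpl.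
      transitivity (cos th * cos th * (sin th * sin th + cos th * cos th)).
      + destruct Hs as [-> | ->]; ring.
      + rewrite Hsc; ring.
    - replace (Im (1 - w s)%C * / Re (1 - w s)%C) with (tan (s * th)).
      + apply atan_tan. destruct Hs as [-> | ->]; lra.
      + destruct Hs as [-> | ->]; unfold tan, w, Re, Im; simpl.
        * rewrite Rmult_1_l. field; repeat split; nra.
        * replace (-1 * th) with (- th) by ring. rewrite sin_neg, cos_neg.
          field; repeat split; nra. }
  assert (Hpow : forall s, s = 1 \/ s = -1 ->
    Cpow_real (1 - w s) p = (- exp (p * (ln (cos th * cos th) / 2)), 0)).
  { intros s Hs. unfold Cpow_real. rewrite Hlog by assumption.
    unfold Cexp, Cmult, RtoC, Re, Im; simpl.
    rewrite !Rmult_0_l, Rminus_0_r, Rplus_0_r.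
    replace (p * (s * th)) with (s * PI) by (rewrite <- Hpth; ring).
    destruct Hs as [-> | ->].
    - rewrite Rmult_1_l, cos_PI, sin_PI. f_equal; ring.
    - replace (-1 * PI) with (- PI) by ring. rewrite cos_neg, sin_neg, cos_PI, sin_PI.
      f_equal; ring. }
  assert (Heq : extremal p (w 1) = extremal p (w (-1))).
  { unfold extremal. now rewrite !Hpow by auto. }
  specialize (Huniv _ _ (Hdisk 1 (or_introl eq_refl))
    (Hdisk (-1) (or_intror eq_refl)) Heq).
  apply (f_equal Im) in Huniv. unfold w, Im in Huniv; simpl in Huniv. nra.
Qed.

Theorem theorem1 (alpha : R) (halpha : (3 / 2 < alpha)%R) :
  ~ (forall h : C -> C, class_G alpha h -> class_S h) /\
  (exists h : C -> C, class_G alpha h /\ ~ univalent_on_disk h).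
Proof.
  assert (HG : class_G alpha (extremal (2 * alpha - 1))) by (apply class_G_extremal; lra).
  assert (Hnot : ~ univalent_on_disk (extremal (2 * alpha - 1)))
    by (apply extremal_not_univalent; lra).
  split.
  - intros Hsub. exact (Hnot (proj2 (Hsub _ HG))).
  - now exists (extremal (2 * alpha - 1)).
Qed.
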